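(* Let $1\to N\to G\xrightarrow{\pi}Q\to1$ be a short exact sequence of groups, let $M$ be a $G$-module on which $N$ acts trivially, and let $[d]=d\in H^1(N,M)^Q\cong\mathrm{Hom}_G(N/N',M)$, where $N'$ is the commutator subgroup of $N$. Then $\mathrm{tr}[d]=-d_*[\epsilon]$, or equivalently, $\mathrm{tr}[-d]=d_*[\epsilon]$, in $H^2(Q,M)$, where $$\epsilon:\quad 0\to N/N'\to G/N'\to Q\to 1$$ and $d_*:H^2(Q,N/N')\to H^2(Q,M)$ is the map induced by $d:N/N'\to M$.
   Context: $N$ is regarded as a normal subgroup of $G$; $M$ is written additively. Since $N$ acts trivially on $M$, $M^N=M$ is a $Q$-module, and inner derivations $N\to M$ vanish. Hence $H^1(N,M)=\mathrm{Hom}(N,M)$, and $H^1(N,M)^Q$ is identified with $\mathrm{Hom}_G(N/N',M)$, where $G$ acts on $N/N'$ by conjugation. $H^2(Q,A)$ is identified with equivalence classes of extensions of $Q$ by $A$ inducing the given action. The map $\mathrm{tr}:H^1(N,M)^Q\to H^2(Q,M^N)$ is defined (for a general $G$-module $M$) as follows. For a derivation $d:N\to M$ with $[d]\in H^1(N,M)^Q$, put $H=\{(d(n),n)\mid n\in N\}\le M\rtimes G$, where $M\rtimes G$ has law $(m,g)(m',g')=(m+g\cdot m',gg')$. Then $\mathrm{tr}[d]$ is the class of $0\to M^N\to N_{M\rtimes G}(H)/H\to Q\to1$, with first map induced by $m\mapsto(m,1)$ and second by $(m,g)\mapsto\pi(g)$. *)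

(* Defs.v *)
From HB Require Import structures.
From mathcomp Require Import all_boot all_order all_algebra.
From mathcomp Require Import boolp classical_sets functions.
Import GRing.Theory.

Set Implicit Arguments.
Unset Strict Implicit.
Unset Printing Implicit Defensive.

Local Open Scope ring_scope.
Local Open Scope quotient_scope.

Record subg (G : groupType) (S : groupClosed G) :=
  SubG { sgval : G; sgvalP : sgval \in S }.
HB.instance Definition _ G S := [isSub for @sgval G S].
HB.instance Definition _ G S := [Choice of @subg G S by <:].

Lemma subg_closed G (S : groupClosed G) : group_closed [pred x in S].
Proof. by split=> [|x y]; rewrite !inE; [exact: gpred1 | exact: gpredF]. Qed.
HB.instance Definition _ G (S : groupClosed G) :=
  SubChoice_isSubGroup.Build G [pred x in S] (subg S) (subg_closed S).

HB.mixin Record isConjClosed (G : groupType) (S : {pred G}) := {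
  gpredJr : forall x g : G, x \in S -> (x ^ g)%g \in S
}.
#[short(type="normalClosed")]
HB.structure Definition NormalClosed G := {S of isConjClosed G S & GroupClosed G S}.

Section QuotientGroup.
Variables (G : groupType) (H : normalClosed G).

Definition coset_equiv : rel G := fun x y => (x^-1 * y)%g \in H.

Lemma coset_equiv_is_equiv : equiv_class_of coset_equiv.
Proof.
split=> [x|x y|y x z]; rewrite /coset_equiv ?mulVg ?gpred1 //.
  by rewrite -gpredV invgM invgK.
by move=> Hxy Hyz; rewrite -(mulgK y x^-1)%g -mulgA gpredM.
Qed.
Canonical coset_equiv_equiv := EquivRelPack coset_equiv_is_equiv.
Canonical coset_equiv_encModRel := defaultEncModRel coset_equiv.

Definition quotg := {eq_quot coset_equiv}.
HB.instance Definition _ : EqQuotient G coset_equiv quotg := EqQuotient.on quotg.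
HB.instance Definition _ := Choice.on quotg.

Definition coset (x : G) : quotg := \pi_quotg x.

Lemma coset_eq x y : coset x = coset y <-> (x^-1 * y)%g \in H.
Proof. by split=> [/eqmodP|h]; last apply/eqmodP. Qed.

Lemma cosetK (c : quotg) : coset (repr c) = c.
Proof. exact: reprK. Qed.

Lemma coset_ind (P : quotg -> Prop) : (forall x, P (coset x)) -> forall c, P c.
Proof. by move=> h c; rewrite -(cosetK c). Qed.

Definition quotg_one : quotg := coset 1%g.
Definition quotg_inv (c : quotg) : quotg := coset (repr c)^-1%g.
Definition quotg_mul (c c' : quotg) : quotg := coset (repr c * repr c')%g.

Lemma quotg_invE x : quotg_inv (coset x) = coset x^-1%g.
Proof.
apply/coset_eq; rewrite invgK.
have /coset_eq := cosetK (coset x); set y := repr _ => h.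
rewrite -gpredV invgM invgK.
by have := gpredJr _ y^-1%g h; rewrite /conjg invgK !mulgA mulgV mul1g.
Qed.

Lemma quotg_mulE x y : quotg_mul (coset x) (coset y) = coset (x * y)%g.
Proof.
apply/coset_eq; rewrite -/coset.
have /coset_eq hx := cosetK (coset x); have /coset_eq hy := cosetK (coset y).
move: (repr (coset x)) (repr (coset y)) hx hy => x' y' hx hy.
have -> : ((x' * y')^-1 * (x * y) = (x'^-1 * x) ^ y' * (y'^-1 * y))%g.
  by rewrite /conjg invgM !mulgA mulgK.
by rewrite gpredM // gpredJr.
Qed.

Lemma quotg_mulA : associative quotg_mul.
Proof.
by move=> a b c; elim/coset_ind: a => x; elim/coset_ind: b => y; elim/coset_ind: c => z;
  rewrite !quotg_mulE mulgA.
Qed.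
Lemma quotg_mul1 : left_id quotg_one quotg_mul.
Proof. by move=> c; elim/coset_ind: c => x; rewrite quotg_mulE mul1g. Qed.
Lemma quotg_mulr1 : right_id quotg_one quotg_mul.
Proof. by move=> c; elim/coset_ind: c => x; rewrite quotg_mulE mulg1. Qed.
Lemma quotg_mulV : left_inverse quotg_one quotg_inv quotg_mul.
Proof. by move=> c; elim/coset_ind: c => x; rewrite quotg_invE quotg_mulE mulVg. Qed.
Lemma quotg_mulrV : right_inverse quotg_one quotg_inv quotg_mul.
Proof. by move=> c; elim/coset_ind: c => x; rewrite quotg_invE quotg_mulE mulgV. Qed.
HB.instance Definition _ := isGroup.Build quotg
  quotg_mulA quotg_mul1 quotg_mulr1 quotg_mulV quotg_mulrV.

Lemma cosetM x y : coset (x * y)%g = (coset x * coset y)%g.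
Proof. by rewrite -quotg_mulE. Qed.
Lemma coset1 : coset 1%g = 1%g. Proof. by []. Qed.
Lemma cosetV x : coset x^-1%g = (coset x)^-1%g.
Proof. by rewrite -quotg_invE. Qed.
Lemma coset_eq1 x : coset x = 1%g <-> x \in H.
Proof. by rewrite -coset1 coset_eq mulg1 gpredV. Qed.

Definition quotg_lift (T : Type) (f : G -> T) : quotg -> T := fun c => f (repr c).
Lemma quotg_liftE T (f : G -> T) x :
  (forall x y, (x^-1 * y)%g \in H -> f x = f y) -> quotg_lift f (coset x) = f x.
Proof. by move=> h; apply: h; apply/coset_eq/cosetK. Qed.

End QuotientGroup.
Arguments coset {G} H x.

Section Abelianization.
Variable T : groupType.

Definition derg : {pred T} := fun x =>
  `[< forall S : groupClosed T, (forall y z : T, [~ y, z]%g \in S) -> x \in S >].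

Lemma dergP x : reflect
  (forall S : groupClosed T, (forall y z : T, [~ y, z]%g \in S) -> x \in S)
  (x \in derg).
Proof. exact: asboolP. Qed.

Lemma derg_comm x y : [~ x, y]%g \in derg.
Proof. by apply/dergP. Qed.
Lemma dergM : mulg_closed derg.
Proof. by move=> x y /dergP hx /dergP hy; apply/dergP=> S hS; rewrite gpredM ?hx ?hy. Qed.
Lemma derg1 : 1%g \in derg.
Proof. by apply/dergP=> S hS; rewrite gpred1. Qed.
Lemma dergV : invg_closed derg.
Proof. by move=> x /dergP hx; apply/dergP=> S hS; rewrite gpredV hx. Qed.
Lemma dergJ x g : x \in derg -> (x ^ g)%g \in derg.
Proof.
by move=> hx; rewrite -(mulVKg x (x ^ g)%g) -commgEl dergM // derg_comm.
Qed.
HB.instance Definition _ := isMulClosed.Build T derg dergM.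
HB.instance Definition _ := isMul1Closed.Build T derg derg1.
HB.instance Definition _ := isInvClosed.Build T derg dergV.
HB.instance Definition _ := isConjClosed.Build T derg dergJ.

(* T/T', with its zmodType structure given by the group law of T/T' *)
Definition abz := quotg derg.
HB.instance Definition _ := Choice.on abz.

Lemma abz_addC : commutative (fun a b : quotg derg => (a * b)%g).
Proof.
move=> a b; elim/coset_ind: a => x; elim/coset_ind: b => y; rewrite -!cosetM; apply/coset_eq.
by rewrite invgM -mulgA; exact: (derg_comm y x).
Qed.
HB.instance Definition _ := GRing.isZmodule.Build abz
  (@mulgA (quotg derg)) abz_addC (@mul1g (quotg derg)) (@mulVg (quotg derg)).

Definition abc (x : T) : abz := coset derg x.
Lemma abcM x y : abc (x * y)%g = abc x + abc y. Proof. exact: cosetM. Qed.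

End Abelianization.
Arguments derg T x : clear implicits.

Record gmodule (G : groupType) := GModule {
  gcar :> zmodType;
  gact : G -> gcar -> gcar;
  gactD : forall g, {morph gact g : a b / a + b};
  gact1 : forall a, gact 1%g a = a;
  gactM : forall g h a, gact (g * h)%g a = gact g (gact h a)
}.

Section GModuleTheory.
Variables (G : groupType) (A : gmodule G).
Lemma gact0 (g : G) : gact g 0 = 0 :> A.
Proof. by apply: (addrI (gact g 0)); rewrite -gactD !addr0. Qed.
Lemma gactN (g : G) : {morph @gact G A g : a / - a}.
Proof. by move=> a; apply: (addrI (gact g a)); rewrite -gactD !subrr gact0. Qed.
Lemma gactB (g : G) : {morph @gact G A g : a b / a - b}.
Proof. by move=> a b; rewrite gactD gactN. Qed.
Lemma gactK (g : G) : cancel (@gact G A g) (gact g^-1%g).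
Proof. by move=> a; rewrite -gactM mulVg gact1. Qed.
Lemma gactKV (g : G) : cancel (@gact G A g^-1%g) (gact g).
Proof. by move=> a; rewrite -gactM mulgV gact1. Qed.
End GModuleTheory.

Record ghom (G : groupType) (A B : gmodule G) := GHom {
  ghom_fun :> {additive A -> B};
  ghomE : forall g a, ghom_fun (gact g a) = gact g (ghom_fun a)
}.

Section Invariants.
Variables (G : groupType) (S : {pred G}) (M : gmodule G).

Definition inv_pred : {pred M} := fun m => `[< forall s, s \in S -> gact s m = m >].
Lemma inv_predP m : reflect (forall s, s \in S -> gact s m = m) (m \in inv_pred).
Proof. exact: asboolP. Qed.
Lemma inv_pred_closed : zmod_closed inv_pred.
Proof.
split=> [|a b /inv_predP ha /inv_predP hb]; apply/inv_predP => s hs.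
  exact: gact0.
by rewrite gactB ha ?hb.
Qed.
HB.instance Definition _ := GRing.isZmodClosed.Build M inv_pred inv_pred_closed.

Record invariants := Invariant { inval : M; invalP : inval \in inv_pred }.
HB.instance Definition _ := [isSub for inval].
HB.instance Definition _ := [Choice of invariants by <:].
HB.instance Definition _ := [SubChoice_isSubZmodule of invariants by <:].

Lemma inval_zmod_morphism : zmod_morphism inval.
Proof. by []. Qed.
HB.instance Definition _ :=
  GRing.isZmodMorphism.Build invariants M inval inval_zmod_morphism.
End Invariants.
Arguments inv_pred {G} S M.
Arguments invariants {G} S M.

Section NormalSubgroup.
Variables (G : groupType) (N : normalClosed G).

Lemma normJV (g n : G) : n \in N -> (g * n * g^-1)%g \in N.
Proof. by move=> hn; have := gpredJr _ g^-1%g hn; rewrite /conjg invgK mulgA. Qed.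

Definition conjN (g : G) (n : subg N) : subg N := SubG (normJV g (sgvalP n)).
Lemma conjNM g : {morph conjN g : x y / (x * y)%g}.
Proof. by move=> x y; apply: val_inj; rewrite /= !mulgA mulgVK. Qed.
HB.instance Definition _ g := isMultiplicative.Build _ _ (conjN g) (conjNM g).

Lemma conjN1 n : conjN 1%g n = n.
Proof. by apply: val_inj; rewrite /= mul1g invg1 mulg1. Qed.
Lemma conjNMl g h n : conjN (g * h)%g n = conjN g (conjN h n).
Proof. by apply: val_inj; rewrite /= invgM !mulgA. Qed.

Variable M : gmodule G.

Lemma invN_act_closed g (m : invariants N M) : gact g (inval m) \in inv_pred N M.
Proof.
apply/inv_predP => n hn; have /inv_predP hm := invalP m.
have -> : (gact n (gact g (inval m)) = gact g (gact (n ^ g)%g (inval m))).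
  by rewrite -!gactM /conjg mulVKg.
by rewrite hm // gpredJr.
Qed.
Definition invN_act g m : invariants N M := Invariant (invN_act_closed g m).
Lemma invN_actD g : {morph invN_act g : a b / a + b}.
Proof. by move=> a b; apply: val_inj; rewrite /= gactD. Qed.
Lemma invN_act1 a : invN_act 1%g a = a.
Proof. by apply: val_inj; rewrite /= gact1. Qed.
Lemma invN_actM g h a : invN_act (g * h)%g a = invN_act g (invN_act h a).
Proof. by apply: val_inj; rewrite /= gactM. Qed.

Definition invN : gmodule G := GModule invN_actD invN_act1 invN_actM.
Lemma invN_triv (n : G) : n \in N -> forall m : invN, gact n m = m.
Proof. by move=> hn m; apply: val_inj; have /inv_predP := invalP m; apply. Qed.

Definition invN_incl : ghom invN M :=
  @GHom G invN M (@inval G N M) (fun g a => erefl).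

End NormalSubgroup.

Section Quot.
Variables (V W : zmodType) (I : zmodClosed V) (J : zmodClosed W).

Definition cls (v : V) : Quotient.quot I := \pi_(Quotient.quot I) v.
Lemma clsB : zmod_morphism cls. Proof. by move=> x y; rewrite /cls !piE. Qed.
HB.instance Definition _ :=
  GRing.isZmodMorphism.Build V (Quotient.quot I) cls clsB.
Lemma cls_eq u v : cls u = cls v <-> u - v \in I.
Proof. by rewrite Quotient.idealrBE; split=> /eqP. Qed.
Lemma cls_ind (P : Quotient.quot I -> Prop) : (forall v, P (cls v)) -> forall c, P c.
Proof. by move=> h c; rewrite -[c]reprK; apply: h. Qed.
End Quot.
Arguments cls {V} I v.

Section QuotMap.
Variables (V W : zmodType) (I : zmodClosed V) (J : zmodClosed W).
Definition quot_map (f : V -> W) (c : Quotient.quot I) : Quotient.quot J :=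
  cls J (f (repr c)).
Lemma quot_mapE (f : {additive V -> W}) v : (forall v, v \in I -> f v \in J) ->
  quot_map f (cls I v) = cls J (f v).
Proof. by move=> h; apply/cls_eq; rewrite -raddfB; apply/h/cls_eq; exact: reprK. Qed.
End QuotMap.
Arguments quot_map {V W} I J f c.

Section H1.
Variables (G : groupType) (N : normalClosed G) (M : gmodule G).

Definition Z1_pred : {pred subg N -> M} := fun d =>
  `[< forall x y, d (x * y)%g = d x + gact (sgval x) (d y) >].
Lemma Z1_predP d :
  reflect (forall x y, d (x * y)%g = d x + gact (sgval x) (d y)) (d \in Z1_pred).
Proof. exact: asboolP. Qed.
Lemma Z1_closed : zmod_closed Z1_pred.
Proof.
split=> [|a b /Z1_predP ha /Z1_predP hb]; apply/Z1_predP => x y.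
  by rewrite gact0 addr0.
by rewrite !fctE ha hb gactB opprD addrACA.
Qed.
HB.instance Definition _ := GRing.isZmodClosed.Build (subg N -> M) Z1_pred Z1_closed.

Record Z1 := Derivation { der :> subg N -> M; derP : der \in Z1_pred }.
HB.instance Definition _ := [isSub for der].
HB.instance Definition _ := [Choice of Z1 by <:].
HB.instance Definition _ := [SubChoice_isSubZmodule of Z1 by <:].

Lemma derM (d : Z1) x y : d (x * y)%g = d x + gact (sgval x) (d y).
Proof. by have /Z1_predP := derP d. Qed.
Lemma der1 (d : Z1) : d 1%g = 0.
Proof.
have := derM d 1%g 1%g; rewrite mulg1 gact1 => h.
by apply: (addrI (d 1%g)); rewrite -h addr0.
Qed.

Definition B1 : {pred Z1} := fun d : Z1 =>
  `[< exists m, forall n, d n = gact (sgval n) m - m >].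
Lemma B1P (d : Z1) : reflect (exists m, forall n, d n = gact (sgval n) m - m) (d \in B1).
Proof. exact: asboolP. Qed.
Lemma B1_closed : zmod_closed B1.
Proof.
split=> [|a b /B1P [m hm] /B1P [k hk]]; apply/B1P.
  by exists 0 => n; rewrite gact0 subrr.
exists (m - k) => n; rewrite -[LHS]/(a n - b n) hm hk gactB.
by rewrite !opprD !opprK addrACA.
Qed.
HB.instance Definition _ := GRing.isZmodClosed.Build Z1 B1 B1_closed.

Definition H1 := Quotient.quot B1.
HB.instance Definition _ := GRing.Zmodule.on H1.

(* (g d)(n) = g d(g^-1 n g) *)
Lemma Z1_act_closed (g : G) (d : Z1) :
  (fun n => gact g (d (conjN g^-1%g n))) \in Z1_pred.
Proof.
apply/Z1_predP => x y; rewrite conjNM derM gactD -gactM; congr (_ + _).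
by rewrite /= -gactM invgK !mulgA mulgV mul1g.
Qed.
Definition Z1_act g d : Z1 := Derivation (Z1_act_closed g d).
Lemma Z1_actB g : zmod_morphism (Z1_act g).
Proof. by move=> a b; apply: val_inj; apply/funext => n; exact: gactB. Qed.
HB.instance Definition _ g :=
  GRing.isZmodMorphism.Build Z1 Z1 (Z1_act g) (Z1_actB g).

Lemma Z1_act_B1 g (d : Z1) : d \in B1 -> Z1_act g d \in B1.
Proof.
move=> /B1P [m hm]; apply/B1P; exists (gact g m) => n /=.
by rewrite hm gactB /= -!gactM invgK !mulgA mulgV mul1g.
Qed.

Definition H1_act (g : G) : H1 -> H1 := quot_map B1 B1 (Z1_act g).
Lemma H1_actE g d : H1_act g (cls B1 d) = cls B1 (Z1_act g d).
Proof. by apply: quot_mapE; exact: Z1_act_B1. Qed.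
Lemma H1_actD g : {morph H1_act g : a b / a + b}.
Proof.
move=> a b; elim/cls_ind: a => a; elim/cls_ind: b => b.
by rewrite -raddfD !H1_actE -raddfD -raddfD.
Qed.
Lemma H1_act1 a : H1_act 1%g a = a.
Proof.
elim/cls_ind: a => a; rewrite H1_actE; congr (cls B1 _).
by apply: val_inj; apply/funext => n; rewrite /= gact1 invg1 conjN1.
Qed.
Lemma H1_actM g h a : H1_act (g * h)%g a = H1_act g (H1_act h a).
Proof.
elim/cls_ind: a => a; rewrite !H1_actE; congr (cls B1 _).
by apply: val_inj; apply/funext => n; rewrite /= gactM invgM conjNMl.
Qed.
Definition H1mod : gmodule G := GModule H1_actD H1_act1 H1_actM.

Lemma H1mod_triv (n : G) : n \in N -> forall c : H1mod, gact n c = c.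
Proof.
move=> hn c; elim/cls_ind: c => d; rewrite -[LHS]/(H1_act n _) H1_actE.
apply/cls_eq/B1P; pose n0 := SubG hn; exists (d n0) => x.
rewrite -[LHS]/(gact n (d (conjN n^-1%g x)) - d x).
have e : (n0 * conjN n^-1%g x = x * n0)%g.
  by apply: val_inj; rewrite /= invgK !mulgA mulgV mul1g.
have := derM d n0 (conjN n^-1%g x); rewrite e derM /= => h.
by apply/eqP; rewrite subr_eq addrAC eq_sym subr_eq addrC h addrC.
Qed.

End H1.
Arguments B1 {G} N M.
Arguments Z1 {G} N M.
Arguments H1 {G} N M.

(* 1 -> N -> G -> Q -> 1, with N = ses_ker regarded as a normal subgroup of G *)

Record ses (G Q : groupType) := SES {
  ses_ker : normalClosed G;
  ses_proj : {multiplicative G -> Q};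
  ses_surj : forall q, exists g, ses_proj g = q;
  ses_kerP : forall g, g \in ses_ker <-> ses_proj g = 1%g
}.

Section Descend.
Variables (G Q : groupType) (S : ses G Q).
Notation N := (ses_ker S).
Notation p := (ses_proj S).

Lemma ses_proj1 : p 1%g = 1%g.
Proof. by apply/(ses_kerP S); exact: gpred1. Qed.
Lemma ses_projV g : p g^-1%g = (p g)^-1%g.
Proof. by apply: (mulgI (p g)); rewrite -gmulfM !mulgV ses_proj1. Qed.

Definition ses_lift (q : Q) : G := projT1 (cid (ses_surj S q)).
Lemma ses_liftK q : p (ses_lift q) = q.
Proof. by rewrite /ses_lift; case: cid. Qed.

Variable A : gmodule G.
Hypothesis NA : forall n, n \in N -> forall a : A, gact n a = a.

Lemma gact_proj g h (a : A) : p g = p h -> gact g a = gact h a.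
Proof.
move=> e; rewrite -[g](mulVKg h) gactM [gact (h^-1 * g)%g a]NA //.
by apply/(ses_kerP S); rewrite gmulfM ses_projV e mulVg.
Qed.

(* The Q-module structure on A: q acts as any g with p g = q, cf. descend_actE *)
Definition descend_act (q : Q) : A -> A := gact (ses_lift q).
Lemma descend_actE g a : descend_act (p g) a = gact g a.
Proof. by apply: gact_proj; rewrite ses_liftK. Qed.
Lemma descend_actD q : {morph descend_act q : a b / a + b}.
Proof. exact: gactD. Qed.
Lemma descend_act1 a : descend_act 1%g a = a.
Proof. by rewrite -ses_proj1 descend_actE gact1. Qed.
Lemma descend_actM q r a : descend_act (q * r)%g a = descend_act q (descend_act r a).
Proof.
by rewrite -{1}(ses_liftK q) -{1}(ses_liftK r) -gmulfM descend_actE gactM.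
Qed.
Definition descend : gmodule Q := GModule descend_actD descend_act1 descend_actM.
Lemma descendE g (a : A) : gact (p g) (a : descend) = gact g a.
Proof. exact: descend_actE. Qed.
End Descend.

Definition descend_hom G Q (S : ses G Q) (A B : gmodule G)
    (NA : forall n, n \in ses_ker S -> forall a : A, gact n a = a)
    (NB : forall n, n \in ses_ker S -> forall b : B, gact n b = b)
    (f : ghom A B) : ghom (descend NA) (descend NB) :=
  @GHom Q (descend NA) (descend NB) f (fun q a => ghomE f (ses_lift S q) a).

(* H^1(N, M)^Q: N acts trivially on H^1(N, M), which is thus a Q-module *)
Definition H1Q G Q (S : ses G Q) (M : gmodule G) :=
  invariants predT (descend (@H1mod_triv G (ses_ker S) M)).
HB.instance Definition _ G Q S M := GRing.Zmodule.on (@H1Q G Q S M).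

Section H2.
Variables (Q : groupType) (A : gmodule Q).

Definition Z2_pred : {pred Q -> Q -> A} := fun f =>
  `[< forall x y z, gact x (f y z) + f x (y * z)%g = f x y + f (x * y)%g z >].
Lemma Z2_predP f : reflect
  (forall x y z, gact x (f y z) + f x (y * z)%g = f x y + f (x * y)%g z) (f \in Z2_pred).
Proof. exact: asboolP. Qed.
Lemma Z2_closed : zmod_closed Z2_pred.
Proof.
split=> [|a b /Z2_predP ha /Z2_predP hb]; apply/Z2_predP => x y z.
  by rewrite gact0.
by rewrite !fctE gactB addrACA -opprD ha hb opprD addrACA.
Qed.
HB.instance Definition _ := GRing.isZmodClosed.Build (Q -> Q -> A) Z2_pred Z2_closed.

Record Z2 := Cocycle { coc :> Q -> Q -> A; cocP : coc \in Z2_pred }.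
HB.instance Definition _ := [isSub for coc].
HB.instance Definition _ := [Choice of Z2 by <:].
HB.instance Definition _ := [SubChoice_isSubZmodule of Z2 by <:].

Definition B2 : {pred Z2} := fun f : Z2 =>
  `[< exists h : Q -> A, forall x y, f x y = gact x (h y) - h (x * y)%g + h x >].
Lemma B2P (f : Z2) : reflect
  (exists h : Q -> A, forall x y, f x y = gact x (h y) - h (x * y)%g + h x) (f \in B2).
Proof. exact: asboolP. Qed.
Lemma B2_closed : zmod_closed B2.
Proof.
split=> [|a b /B2P [h hh] /B2P [k hk]]; apply/B2P.
  by exists (fun=> 0) => x y; rewrite gact0 subrr addr0.
exists (fun x => h x - k x) => x y.
rewrite -[LHS]/(a x y - b x y) hh hk gactB opprD addrACA.
by congr (_ + _); rewrite !opprD addrACA.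
Qed.
HB.instance Definition _ := GRing.isZmodClosed.Build Z2 B2 B2_closed.

Definition H2 := Quotient.quot B2.
HB.instance Definition _ := GRing.Zmodule.on H2.
End H2.
Arguments Z2_pred {Q} A.
Arguments Z2 {Q} A.
Arguments B2 {Q} A.
Arguments H2 {Q} A.

Section H2Map.
Variables (Q : groupType) (A B : gmodule Q) (phi : ghom A B).

Lemma Z2_map_closed (f : Z2 A) : (fun x y => phi (f x y)) \in Z2_pred B.
Proof.
apply/Z2_predP => x y z; rewrite -ghomE -!raddfD.
by have /Z2_predP -> := cocP f.
Qed.
Definition Z2_map f : Z2 B := Cocycle (Z2_map_closed f).
Lemma Z2_mapB : zmod_morphism Z2_map.
Proof.
move=> a b; apply: val_inj; apply/funext => x; apply/funext => y.
exact: raddfB.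
Qed.
HB.instance Definition _ := GRing.isZmodMorphism.Build (Z2 A) (Z2 B) Z2_map Z2_mapB.
Lemma Z2_map_B2 (f : Z2 A) : f \in B2 A -> Z2_map f \in B2 B.
Proof.
move=> /B2P [h hh]; apply/B2P; exists (fun x => phi (h x)) => x y /=.
by rewrite hh raddfD raddfB ghomE.
Qed.
Definition H2_map : H2 A -> H2 B := quot_map (B2 A) (B2 B) Z2_map.
Lemma H2_mapE f : H2_map (cls (B2 A) f) = cls (B2 B) (Z2_map f).
Proof. by apply: quot_mapE; exact: Z2_map_B2. Qed.
End H2Map.

Record extension (Q : groupType) (A : gmodule Q) := Extension {
  ext_grp : groupType;
  ext_i : A -> ext_grp;
  ext_p : ext_grp -> Q;
  ext_iD : forall a b, ext_i (a + b) = (ext_i a * ext_i b)%g;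
  ext_pM : {morph ext_p : x y / (x * y)%g};
  ext_inj : injective ext_i;
  ext_surj : forall q, exists e, ext_p e = q;
  ext_exact : forall e, ext_p e = 1%g <-> exists a, ext_i a = e;
  ext_act : forall e a, (e * ext_i a * e^-1)%g = ext_i (gact (ext_p e) a)
}.

Section ExtensionClass.
Variables (Q : groupType) (A : gmodule Q) (E : extension A).
Notation i := (@ext_i _ _ E).
Notation p := (@ext_p _ _ E).

Lemma ext_p1 : p 1%g = 1%g.
Proof. by apply: (mulgI (p 1%g)); rewrite -ext_pM !mulg1. Qed.
Lemma ext_pV e : p e^-1%g = (p e)^-1%g.
Proof. by apply: (mulgI (p e)); rewrite -ext_pM !mulgV ext_p1. Qed.
Lemma ext_i0 : i 0 = 1%g.
Proof. by apply: (mulgI (i 0)); rewrite -ext_iD addr0 mulg1. Qed.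
Lemma ext_iN a : i (- a) = (i a)^-1%g.
Proof. by apply: (mulgI (i a)); rewrite -ext_iD subrr mulgV ext_i0. Qed.
Lemma ext_comm e a : (e * i a = i (gact (p e) a) * e)%g.
Proof. by rewrite -ext_act mulgVK. Qed.
Lemma ext_pi a : p (i a) = 1%g.
Proof. by apply/ext_exact; exists a. Qed.

Section FactorSet.
Variables (s : Q -> ext_grp E) (sK : cancel s p).

Lemma factor_ex x y : exists a, i a = (s x * s y * (s (x * y))^-1)%g.
Proof. by apply/ext_exact; rewrite !ext_pM ext_pV !sK mulgV. Qed.
(* s x * s y = i (factor x y) * s (x * y) *)
Definition factor x y : A := projT1 (cid (factor_ex x y)).
Lemma factorE x y : (i (factor x y) * s (x * y) = s x * s y)%g.
Proof. by rewrite /factor; case: cid => a /= ->; rewrite mulgVK. Qed.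
Lemma factor_closed : factor \in Z2_pred A.
Proof.
apply/Z2_predP => x y z; apply: (@ext_inj _ _ E).
apply: (mulIg (s (x * y * z)%g)); rewrite !ext_iD.
transitivity (s x * (s y * s z))%g.
  rewrite -mulgA -[(x * y * z)%g]mulgA factorE -{1}[x]sK mulgA -ext_comm.
  by rewrite -mulgA factorE.
by rewrite -[RHS]mulgA factorE [RHS]mulgA factorE mulgA.
Qed.
Definition factor_set : Z2 A := Cocycle factor_closed.
End FactorSet.

Lemma ext_section : exists s : Q -> ext_grp E, cancel s p.
Proof.
exists (fun q => projT1 (cid (ext_surj E q))) => q.
by case: cid.
Qed.

(* The class of the factor set of any section, cf. ext_classE *)
Definition ext_class : H2 A :=
  let: exist _ sK := cid ext_section in cls (B2 A) (factor_set sK).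

Lemma ext_classE s (sK : cancel s p) : ext_class = cls (B2 A) (factor_set sK).
Proof.
rewrite /ext_class; case: (cid _) => t tK; apply/cls_eq/B2P.
have hx q : exists a, i a = (t q * (s q)^-1)%g.
  by apply/ext_exact; rewrite ext_pM ext_pV sK tK mulgV.
have [h hh] := choice hx.
have ht q : t q = (i (h q) * s q)%g by rewrite hh mulgVK.
exists h => x y; rewrite -[LHS]/(factor tK x y - factor sK x y).
apply/eqP; rewrite subr_eq; apply/eqP.
apply: (@ext_inj _ _ E); apply: (mulIg (t (x * y)%g)).
rewrite factorE [in RHS]ht !ht [RHS]mulgA -ext_iD.
have -> : gact x (h y) - h (x * y)%g + h x + factor sK x y + h (x * y)%g
  = h x + gact x (h y) + factor sK x y.
  by rewrite addrAC; congr (_ + _); rewrite addrAC subrK addrC.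
rewrite !ext_iD -[RHS]mulgA factorE [LHS]mulgA.
by rewrite -(mulgA (i (h x)) (s x)) (ext_comm (s x)) sK !mulgA.
Qed.

End ExtensionClass.

Section DerPreim.
Variables (T U : groupType) (f : {multiplicative T -> U}) (S : groupClosed U).

Lemma mult1 : f 1%g = 1%g.
Proof. by apply: (mulgI (f 1%g)); rewrite -gmulfM !mulg1. Qed.
Lemma multV x : f x^-1%g = (f x)^-1%g.
Proof. by apply: (mulgI (f x)); rewrite -gmulfM !mulgV mult1. Qed.

Definition preim_pred : {pred T} := fun x => f x \in S.
Lemma preim_predM : mulg_closed preim_pred.
Proof. by move=> x y hx hy; rewrite unfold_in /preim_pred gmulfM gpredM. Qed.
Lemma preim_pred1 : 1%g \in preim_pred.
Proof. by rewrite unfold_in /preim_pred mult1 gpred1. Qed.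
Lemma preim_predV : invg_closed preim_pred.
Proof. by move=> x hx; rewrite unfold_in /preim_pred multV gpredV. Qed.
HB.instance Definition _ := isMulClosed.Build T preim_pred preim_predM.
HB.instance Definition _ := isMul1Closed.Build T preim_pred preim_pred1.
HB.instance Definition _ := isInvClosed.Build T preim_pred preim_predV.
End DerPreim.

Lemma derg_preim (T U : groupType) (f : {multiplicative T -> U}) x :
  x \in derg T -> f x \in derg U.
Proof.
move=> /dergP hx; apply/dergP => S hS; apply: (hx (preim_pred f S)) => y z.
rewrite unfold_in /preim_pred /commg /conjg !(gmulfM, multV).
exact: hS.
Qed.

Section DerivedExtension.
Variables (G : groupType) (N : normalClosed G).

(* N' as a subgroup of G *)
Definition derN : {pred G} := fun g =>
  `[< exists2 n : subg N, n \in derg (subg N) & sgval n = g >].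
Lemma derNP g : reflect
  (exists2 n : subg N, n \in derg (subg N) & sgval n = g) (g \in derN).
Proof. exact: asboolP. Qed.
Lemma derNE (n : subg N) : (sgval n \in derN) = (n \in derg (subg N)).
Proof.
apply/derNP/idP => [[m hm e]|hn]; last by exists n.
by rewrite -(val_inj (e : val m = val n)).
Qed.
Lemma derN_sub g : g \in derN -> g \in N.
Proof. by move=> /derNP [n _ <-]; exact: sgvalP. Qed.
Lemma derNM : mulg_closed derN.
Proof.
move=> x y /derNP [n hn <-] /derNP [m hm <-].
by apply/derNP; exists (n * m)%g; rewrite ?gpredM.
Qed.
Lemma derN1 : 1%g \in derN.
Proof. by apply/derNP; exists 1%g; rewrite ?gpred1. Qed.
Lemma derNV : invg_closed derN.
Proof. by move=> x /derNP [n hn <-]; apply/derNP; exists n^-1%g; rewrite ?gpredV. Qed.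
Lemma derNJ x g : x \in derN -> (x ^ g)%g \in derN.
Proof.
move=> /derNP [n hn <-]; apply/derNP; exists (conjN g^-1%g n).
  exact: derg_preim.
by rewrite /= invgK /conjg mulgA.
Qed.
HB.instance Definition _ := isMulClosed.Build G derN derNM.
HB.instance Definition _ := isMul1Closed.Build G derN derN1.
HB.instance Definition _ := isInvClosed.Build G derN derNV.
HB.instance Definition _ := isConjClosed.Build G derN derNJ.

(* G acts on N/N' by g [n] = [g n g^-1] *)
Definition ab_act (g : G) : abz (subg N) -> abz (subg N) :=
  quotg_lift (fun n => abc (conjN g n)).
Lemma ab_actE g n : ab_act g (abc n) = abc (conjN g n).
Proof.
rewrite /ab_act /abc quotg_liftE // => x y h; apply/coset_eq.
by rewrite -multV -gmulfM; exact: derg_preim.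
Qed.
Lemma ab_actD g : {morph ab_act g : a b / a + b}.
Proof.
move=> a b; elim/coset_ind: a => x; elim/coset_ind: b => y.
by rewrite -[coset _ x]/(abc x) -[coset _ y]/(abc y) -abcM !ab_actE conjNM abcM.
Qed.
Lemma ab_act1 a : ab_act 1%g a = a.
Proof. by elim/coset_ind: a => x; rewrite -[coset _ x]/(abc x) ab_actE conjN1. Qed.
Lemma ab_actM g h a : ab_act (g * h)%g a = ab_act g (ab_act h a).
Proof.
by elim/coset_ind: a => x; rewrite -[coset _ x]/(abc x) !ab_actE conjNMl.
Qed.
Definition abmod : gmodule G := GModule ab_actD ab_act1 ab_actM.

Lemma abmod_triv (n : G) : n \in N -> forall a : abmod, gact n a = a.
Proof.
move=> hn a; elim/coset_ind: a => x; rewrite -[coset _ x]/(abc x).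
rewrite -[LHS]/(ab_act n _) ab_actE; pose n0 := SubG hn.
have -> : conjN n x = (n0 * x * n0^-1)%g by apply: val_inj.
by rewrite !abcM addrAC -(abcM n0 n0^-1) mulgV -[abc 1%g]/(0 : abz (subg N)) add0r.
Qed.

Definition ab_incl : abz (subg N) -> quotg derN :=
  quotg_lift (fun n => coset derN (sgval n)).
Lemma ab_inclE n : ab_incl (abc n) = coset derN (sgval n).
Proof.
rewrite /ab_incl /abc quotg_liftE // => x y h; apply/coset_eq.
by rewrite -[(_ * _)%g]/(sgval (x^-1 * y)%g) derNE.
Qed.
Lemma ab_inclD a b : ab_incl (a + b) = (ab_incl a * ab_incl b)%g.
Proof.
elim/coset_ind: a => x; elim/coset_ind: b => y.
by rewrite -[coset _ x]/(abc x) -[coset _ y]/(abc y) -abcM !ab_inclE -cosetM.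
Qed.
Lemma ab_incl_inj : injective ab_incl.
Proof.
move=> a b; elim/coset_ind: a => x; elim/coset_ind: b => y.
rewrite -[coset _ x]/(abc x) -[coset _ y]/(abc y) !ab_inclE => /coset_eq h.
by apply/coset_eq; rewrite -derNE.
Qed.
End DerivedExtension.

Section Epsilon.
Variables (G Q : groupType) (S : ses G Q).
Notation N := (ses_ker S).
Notation p := (ses_proj S).

Definition ab_proj : quotg (derN N) -> Q := quotg_lift p.
Lemma ab_projE g : ab_proj (coset (derN N) g) = p g.
Proof.
rewrite /ab_proj quotg_liftE // => x y /derN_sub /(ses_kerP S).
rewrite gmulfM ses_projV => h.
by apply: (mulgI (p x)^-1%g); rewrite h mulVg.
Qed.
Lemma ab_projM : {morph ab_proj : x y / (x * y)%g}.
Proof.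
move=> a b; elim/coset_ind: a => x; elim/coset_ind: b => y.
by rewrite -cosetM !ab_projE gmulfM.
Qed.
Lemma ab_proj_surj q : exists e, ab_proj e = q.
Proof. by have [g <-] := ses_surj S q; exists (coset (derN N) g); rewrite ab_projE. Qed.
Lemma ab_exact e : ab_proj e = 1%g <-> exists a, ab_incl a = e.
Proof.
elim/coset_ind: e => g; rewrite ab_projE; split=> [/(ses_kerP S) hg|[a]].
  by exists (abc (SubG hg)); rewrite ab_inclE.
elim/coset_ind: a => n; rewrite -[coset _ n]/(abc n) ab_inclE -ab_projE => <-.
by rewrite ab_projE; apply/(ses_kerP S); exact: sgvalP.
Qed.
Lemma ab_ext_act e (a : descend (@abmod_triv G N)) :
  (e * ab_incl a * e^-1)%g = ab_incl (gact (ab_proj e) a).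
Proof.
elim/coset_ind: e => g; rewrite ab_projE descendE.
elim/coset_ind: a => n; rewrite -[coset _ n]/(abc n).
by rewrite -[gact _ _]/(ab_act g _) ab_actE !ab_inclE -cosetV -!cosetM.
Qed.

Definition ab_ext : extension (descend (@abmod_triv G N)) :=
  @Extension Q (descend (@abmod_triv G N)) (quotg (derN N)) (@ab_incl G N) ab_proj
    (@ab_inclD G N) ab_projM (@ab_incl_inj G N) ab_proj_surj ab_exact ab_ext_act.
End Epsilon.

Section SemidirectProduct.
Variables (G : groupType) (M : gmodule G).
Definition sdprod : Type := M * G.
HB.instance Definition _ := Choice.on sdprod.
Definition sd_one : sdprod := (0, 1%g).
Definition sd_mul (x y : sdprod) : sdprod := (x.1 + gact x.2 y.1, (x.2 * y.2)%g).
Definition sd_inv (x : sdprod) : sdprod := (- gact x.2^-1%g x.1, x.2^-1%g).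
Lemma sd_mulA : associative sd_mul.
Proof. by move=> x y z; rewrite /sd_mul /= gactD gactM mulgA addrA. Qed.
Lemma sd_mul1 : left_id sd_one sd_mul.
Proof. by move=> [m g]; rewrite /sd_mul /= gact1 add0r mul1g. Qed.
Lemma sd_mulr1 : right_id sd_one sd_mul.
Proof. by move=> [m g]; rewrite /sd_mul /= gact0 addr0 mulg1. Qed.
Lemma sd_mulV : left_inverse sd_one sd_inv sd_mul.
Proof. by move=> [m g]; rewrite /sd_mul /sd_inv /= addNr mulVg. Qed.
Lemma sd_mulrV : right_inverse sd_one sd_inv sd_mul.
Proof. by move=> [m g]; rewrite /sd_mul /sd_inv /= gactN gactKV subrr mulgV. Qed.
HB.instance Definition _ :=
  isGroup.Build sdprod sd_mulA sd_mul1 sd_mulr1 sd_mulV sd_mulrV.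
Definition sdp (m : M) (g : G) : sdprod := (m, g).
Lemma sdM m m' g g' : (sdp m g * sdp m' g')%g = sdp (m + gact g m') (g * g')%g.
Proof. by []. Qed.
Lemma sdV m g : (sdp m g)^-1%g = sdp (- gact g^-1%g m) g^-1%g.
Proof. by []. Qed.
End SemidirectProduct.

Section Normalizer.
Variables (T : groupType) (H : groupClosed T).
Definition normalizer : {pred T} := fun x =>
  `[< forall h, ((h ^ x)%g \in H) = (h \in H) >].
Lemma normalizerP x :
  reflect (forall h, ((h ^ x)%g \in H) = (h \in H)) (x \in normalizer).
Proof. exact: asboolP. Qed.
Lemma normalizerM : mulg_closed normalizer.
Proof.
by move=> x y /normalizerP hx /normalizerP hy; apply/normalizerP => h; rewrite conjgM hy hx.
Qed.
Lemma normalizer1 : 1%g \in normalizer.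
Proof. by apply/normalizerP => h; rewrite conjg1. Qed.
Lemma normalizerV : invg_closed normalizer.
Proof. by move=> x /normalizerP hx; apply/normalizerP => h; rewrite -[LHS]hx conjgKV. Qed.
HB.instance Definition _ := isMulClosed.Build T normalizer normalizerM.
HB.instance Definition _ := isMul1Closed.Build T normalizer normalizer1.
HB.instance Definition _ := isInvClosed.Build T normalizer normalizerV.

Definition in_norm : {pred subg normalizer} := fun x => sgval x \in H.
Lemma in_normM : mulg_closed in_norm.
Proof. by move=> x y hx hy; rewrite unfold_in /in_norm gpredM. Qed.
Lemma in_norm1 : 1%g \in in_norm.
Proof. by rewrite unfold_in /in_norm gpred1. Qed.
Lemma in_normV : invg_closed in_norm.
Proof. by move=> x hx; rewrite unfold_in /in_norm gpredV. Qed.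
Lemma in_normJ x g : x \in in_norm -> (x ^ g)%g \in in_norm.
Proof.
have /normalizerP hg := sgvalP g.
rewrite -[x \in _]/(sgval x \in H) -[_ \in in_norm]/((sgval x ^ sgval g)%g \in H).
by rewrite hg.
Qed.
HB.instance Definition _ := isMulClosed.Build _ in_norm in_normM.
HB.instance Definition _ := isMul1Closed.Build _ in_norm in_norm1.
HB.instance Definition _ := isInvClosed.Build _ in_norm in_normV.
HB.instance Definition _ := isConjClosed.Build _ in_norm in_normJ.
Definition norm_quot := quotg in_norm.
HB.instance Definition _ := Group.on norm_quot.
End Normalizer.
Arguments in_norm {T} H x.

Section Graph.
Variables (G : groupType) (N : normalClosed G) (M : gmodule G) (d : Z1 N M).

(* H = {(d n, n) | n in N} *)
Definition graph : {pred sdprod M} := fun x =>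
  `[< exists n : subg N, x = sdp (d n) (sgval n) >].
Lemma graphP x : reflect (exists n : subg N, x = sdp (d n) (sgval n)) (x \in graph).
Proof. exact: asboolP. Qed.
Lemma graphM : mulg_closed graph.
Proof.
move=> x y /graphP [n ->] /graphP [m ->]; apply/graphP; exists (n * m)%g.
by rewrite derM.
Qed.
Lemma graph1 : 1%g \in graph.
Proof. by apply/graphP; exists 1%g; rewrite der1. Qed.
Lemma derV (n : subg N) : d n^-1%g = - gact (sgval n)^-1%g (d n).
Proof.
apply: (addrI (gact (sgval n)^-1%g (d n))); rewrite subrr addrC.
by rewrite -[(sgval n)^-1%g]/(sgval n^-1%g) -derM mulVg der1.
Qed.
Lemma graphV : invg_closed graph.
Proof. by move=> x /graphP [n ->]; apply/graphP; exists n^-1%g; rewrite derV. Qed.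
HB.instance Definition _ := isMulClosed.Build _ graph graphM.
HB.instance Definition _ := isMul1Closed.Build _ graph graph1.
HB.instance Definition _ := isInvClosed.Build _ graph graphV.

Lemma graph_normP (m : M) (g : G) : reflect
  (forall n, m + gact g (d n) - gact (g * sgval n * g^-1)%g m = d (conjN g n))
  (sdp m g \in normalizer graph).
Proof.
have key (n : subg N) : (sdp (d n) (sgval n) ^ (sdp m g)^-1)%g
    = sdp (m + gact g (d n) - gact (g * sgval n * g^-1)%g m) (g * sgval n * g^-1)%g.
  by rewrite /conjg invgK sdV !sdM gactN /= gactB -!gactM !mulgA addrA.
apply: (iffP idP) => [hN n|hN].
  have /normalizerP/(_ (sdp (d n) (sgval n))) : (sdp m g)^-1%g \in normalizer graph.
    by rewrite gpredV.
  rewrite key; have -> : sdp (d n) (sgval n) \in graph by apply/graphP; exists n.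
  by move=> /graphP [n' [-> e]]; congr (d _); apply: val_inj; rewrite /= -e.
rewrite -gpredV; apply/normalizerP => x; apply/idP/idP => [|/graphP [n ->]]; last first.
  by rewrite key hN; apply/graphP; exists (conjN g n).
move=> /graphP [n e]; apply/graphP; exists (conjN g^-1%g n).
apply: (conjg_inj (sdp m g)^-1%g); rewrite e key hN.
by rewrite -!conjNMl /= mulgV conjN1 invgK !mulgA mulgV mul1g mulgK.
Qed.
End Graph.

Section TransgressionExtension.
Variables (G Q : groupType) (S : ses G Q) (M : gmodule G).
Notation N := (ses_ker S).
Notation p := (ses_proj S).
Notation MN := (descend (@invN_triv G N M)).
Variable d : Z1 N M.
Hypothesis hd : cls (B1 N M) d \in inv_pred predT (descend (@H1mod_triv G N M)).
Notation H := (graph d).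

Lemma tr_norm_ex g : exists m, sdp m g \in normalizer H.
Proof.
have /inv_predP/(_ (p g) isT) := hd; rewrite descendE.
rewrite -[gact g _]/(H1_act g _) H1_actE => /cls_eq/B1P [m hm].
exists m; apply/graph_normP => n; have := hm (conjN g n).
rewrite -[LHS]/(gact g (d (conjN g^-1%g (conjN g n))) - d (conjN g n)).
rewrite -conjNMl mulVg conjN1 /= => /eqP; rewrite subr_eq => /eqP ->.
by rewrite addrA [m + _]addrC subrK addrAC subrr add0r.
Qed.

Lemma tr_i_closed (m : MN) : sdp (inval m) 1%g \in normalizer H.
Proof.
apply/graph_normP => n; have /inv_predP := invalP m => hm.
by rewrite conjN1 gact1 mul1g invg1 mulg1 hm ?sgvalP // addrAC subrr add0r.
Qed.

Definition tr_i (m : MN) : norm_quot H := coset (in_norm H) (SubG (tr_i_closed m)).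
Definition tr_p : norm_quot H -> Q :=
  @quotg_lift _ (in_norm H) _ (fun x : subg (normalizer H) => p (sgval x).2).

Lemma tr_pE x : tr_p (coset (in_norm H) x) = p (sgval x).2.
Proof.
rewrite /tr_p quotg_liftE // => {}x y /graphP [n /(congr1 snd) /= e].
apply: (mulgI (p (sgval x).2)^-1%g); rewrite mulVg -ses_projV -gmulfM e.
by apply/esym/(ses_kerP S); exact: sgvalP.
Qed.

Lemma tr_iD a b : tr_i (a + b) = (tr_i a * tr_i b)%g.
Proof.
rewrite /tr_i -cosetM; congr (coset _ _); apply: val_inj.
by rewrite /= sdM gact1 mulg1.
Qed.
Lemma tr_pM : {morph tr_p : x y / (x * y)%g}.
Proof.
move=> a b; elim/coset_ind: a => x; elim/coset_ind: b => y.
by rewrite -cosetM !tr_pE gmulfM.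
Qed.
Lemma tr_inj : injective tr_i.
Proof.
move=> a b /coset_eq /graphP [n].
rewrite /= sdV sdM => -[e1 e2].
have n1 : n = 1%g by apply: val_inj; rewrite /= -e2 invg1 mulg1.
move: e1; rewrite n1 der1 invg1 !gact1 => /eqP.
by rewrite addrC subr_eq0 => /eqP /val_inj ->.
Qed.
Lemma tr_surj q : exists e, tr_p e = q.
Proof.
have [g <-] := ses_surj S q; have [m hm] := tr_norm_ex g.
by exists (coset (in_norm H) (SubG hm)); rewrite tr_pE.
Qed.
Lemma tr_exact e : tr_p e = 1%g <-> exists a, tr_i a = e.
Proof.
elim/coset_ind: e => [[[m g] hx]]; rewrite tr_pE /=; split=> [/(ses_kerP S) hg|[a]]; last first.
  by move=> /(congr1 tr_p); rewrite !tr_pE /= ses_proj1.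
pose n := SubG hg.
have hn : sdp (d n) g \in H by apply/graphP; exists n.
have hm : m - d n \in inv_pred N M.
  have : (sdp m g * (sdp (d n) g)^-1)%g \in normalizer H.
    rewrite gpredM // gpredV; apply/normalizerP => x.
    by rewrite /conjg gpredMl ?gpredV // gpredMr.
  rewrite sdV sdM gactN gactKV mulgV => /graph_normP hm.
  apply/inv_predP => k hk; have := hm (SubG hk).
  rewrite conjN1 gact1 mul1g invg1 mulg1 /= addrAC -[RHS]add0r => /addIr /eqP.
  by rewrite subr_eq0 => /eqP.
exists (Invariant hm); apply/coset_eq/graphP; exists n.
by rewrite /= sdV sdM invg1 !gact1 mul1g addrC opprB addrC subrK.
Qed.
Lemma tr_act e (a : MN) : (e * tr_i a * e^-1)%g = tr_i (gact (tr_p e) a).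
Proof.
elim/coset_ind: e => [[[m g] hx]]; rewrite tr_pE descendE.
transitivity (coset (in_norm H) (SubG hx * SubG (tr_i_closed a) * (SubG hx)^-1)%g).
  by rewrite !cosetM cosetV.
rewrite /tr_i; congr (coset _ _); apply: val_inj => /=.
by rewrite -[(m, g)]/(sdp m g) sdV !sdM /= mulg1 mulgV gactN gactKV addrAC subrr add0r.
Qed.

(* 0 -> M^N -> N_{M x| G}(H)/H -> Q -> 1 *)
Definition tr_ext : extension MN :=
  @Extension Q MN (norm_quot H) tr_i tr_p tr_iD tr_pM tr_inj tr_surj tr_exact tr_act.
End TransgressionExtension.

Lemma ext_class_equiv (Q : groupType) (A : gmodule Q) (E F : extension A)
    (phi : ext_grp E -> ext_grp F) :
  {morph phi : x y / (x * y)%g} -> (forall a, phi (ext_i E a) = ext_i F a) ->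
  (forall e, ext_p (phi e) = ext_p e) -> ext_class E = ext_class F.
Proof.
move=> phiM phii phip; have [s sK] := ext_section E.
have tK : cancel (phi \o s) (@ext_p _ _ F) by move=> q; rewrite /= phip.
rewrite (ext_classE sK) (ext_classE tK); congr (cls _ _); apply: val_inj.
apply/funext => x; apply/funext => y; apply: (@ext_inj _ _ F).
apply: (mulIg (phi (s (x * y)%g))); rewrite [RHS](factorE tK) /=.
by rewrite -phii -phiM factorE phiM.
Qed.

Section Transgression.
Variables (G Q : groupType) (S : ses G Q) (M : gmodule G).
Notation N := (ses_ker S).

Lemma H1Q_repr (c : H1Q S M) :
  cls (B1 N M) (repr (inval c)) \in inv_pred predT (descend (@H1mod_triv G N M)).
Proof. by rewrite /cls reprK; exact: invalP. Qed.

(* tr [d], for any derivation d representing c, cf. trE *)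
Definition tr (c : H1Q S M) : H2 (descend (@invN_triv G N M)) :=
  ext_class (tr_ext (H1Q_repr c)).

Lemma tr_ext_class (d d' : Z1 N M)
    (hd : cls (B1 N M) d \in inv_pred predT (descend (@H1mod_triv G N M)))
    (hd' : cls (B1 N M) d' \in inv_pred predT (descend (@H1mod_triv G N M))) :
  cls (B1 N M) d = cls (B1 N M) d' -> ext_class (tr_ext hd) = ext_class (tr_ext hd').
Proof.
move=> /cls_eq/B1P [m hm]; pose t := sdp m 1%g.
have key n : (sdp (d n) (sgval n) ^ t^-1)%g = sdp (d' n) (sgval n).
  rewrite /conjg invgK sdV !sdM gactN /= !invg1 !gact1 mulg1 mul1g.
  have := hm n; rewrite -[LHS]/(d n - d' n) => /eqP; rewrite subr_eq => /eqP ->.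
  by congr sdp; rewrite addrC [_ - m + _]addrC -!addrA [- m + _]addrC addrK subrr addr0.
have graphJ x : ((x ^ t^-1)%g \in graph d') = (x \in graph d).
  apply/graphP/graphP => [[n]|[n ->]]; exists n; last exact: key.
  by apply: (conjg_inj t^-1%g); rewrite key.
have normJ x : x \in normalizer (graph d) -> (x ^ t^-1)%g \in normalizer (graph d').
  move=> /normalizerP hx; apply/normalizerP => h.
  by rewrite -[h](conjgK t) -conjJg !graphJ hx.
pose f (x : subg (normalizer (graph d))) : norm_quot (graph d') :=
  coset (in_norm (graph d')) (SubG (normJ _ (sgvalP x))).
have fM : {morph f : x y / (x * y)%g}.
  by move=> x y; rewrite /f -cosetM; congr (coset _ _); apply: val_inj; rewrite /= conjMg.
have fE x : quotg_lift f (coset (in_norm (graph d)) x) = f x.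
  rewrite quotg_liftE // => {}x y h; apply/coset_eq.
  rewrite -[_ \in _]/((((sgval x) ^ t^-1)^-1 * (sgval y ^ t^-1))%g \in graph d').
  by rewrite -conjVg -conjMg graphJ.
apply: (@ext_class_equiv _ _ (tr_ext hd) (tr_ext hd') (quotg_lift f)).
- move=> a b; elim/coset_ind: a => x; elim/coset_ind: b => y.
  by rewrite -cosetM !fE fM.
- move=> a; rewrite fE; congr (coset _ _); apply: val_inj.
  rewrite /= /conjg invgK sdV !sdM /= !invg1 !gact1 !mul1g.
  by rewrite addrC -addrA addNr addr0.
- move=> e; elim/coset_ind: e => x; rewrite fE /= !tr_pE /= /conjg invgK.
  by rewrite /= invg1 mulg1 mul1g.
Qed.

Lemma trE (c : H1Q S M) (d : Z1 N M)
    (hd : cls (B1 N M) d \in inv_pred predT (descend (@H1mod_triv G N M))) :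
  inval c = cls (B1 N M) d -> tr c = ext_class (tr_ext hd).
Proof. by move=> hc; apply: tr_ext_class; rewrite /cls reprK. Qed.
End Transgression.

(* H^1(N, M)^Q -> Hom_G(N/N', M), [d] |-> ([n] |-> d n), when N acts trivially on M;
   cf. H1_homE *)

Section H1Hom.
Variables (G Q : groupType) (S : ses G Q) (M : gmodule G).
Notation N := (ses_ker S).
Hypothesis NM : forall n, n \in N -> forall m : M, gact n m = m.

Lemma triv_derD (d : Z1 N M) x y : d (x * y)%g = d x + d y.
Proof. by rewrite derM NM // sgvalP. Qed.

Lemma triv_der_derg (d : Z1 N M) x : x \in derg (subg N) -> d x = 0.
Proof.
pose K : {pred subg N} := fun x => d x == 0.
have dV y : d y^-1%g = - d y by rewrite derV NM // gpredV sgvalP.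
have KM : mulg_closed K.
  by move=> y z /eqP hy /eqP hz; rewrite unfold_in /K triv_derD hy hz addr0.
have K1 : 1%g \in K by rewrite unfold_in /K der1.
have KV : invg_closed K by move=> y /eqP hy; rewrite unfold_in /K dV hy oppr0.
pose K' : groupClosed (subg N) := HB.pack K (isMulClosed.Build _ K KM)
  (isMul1Closed.Build _ K K1) (isInvClosed.Build _ K KV).
move=> /dergP /(_ K') hx; apply/eqP; apply: hx => y z.
by apply/eqP; rewrite /commg /conjg !triv_derD !dV [d y + _]addrC addKr addNr.
Qed.

Lemma triv_B1 (d : Z1 N M) : d \in B1 N M -> d = 0.
Proof.
move=> /B1P [m hm]; apply: val_inj; apply/funext => n.
by rewrite /= hm NM ?subrr // sgvalP.
Qed.

Variable c : H1Q S M.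
Notation d := (repr (inval c) : Z1 N M).

Definition H1_fun : abz (subg N) -> M := quotg_lift d.
Lemma H1_fun_abc n : H1_fun (abc n) = d n.
Proof.
rewrite /H1_fun /abc quotg_liftE // => x y /triv_der_derg h.
by rewrite -[y](mulVKg x) triv_derD h addr0.
Qed.
Lemma H1_funD : {morph H1_fun : a b / a + b}.
Proof.
move=> a b; elim/coset_ind: a => x; elim/coset_ind: b => y.
by rewrite -[coset _ x]/(abc x) -[coset _ y]/(abc y) -abcM !H1_fun_abc triv_derD.
Qed.
Lemma H1_funB : zmod_morphism H1_fun.
Proof. by move=> a b; apply: (addIr (H1_fun b)); rewrite -H1_funD !subrK. Qed.
HB.instance Definition _ := GRing.isZmodMorphism.Build _ _ H1_fun H1_funB.

Lemma H1_fun_act g (a : abmod N) : H1_fun (gact g a) = gact g (H1_fun a).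
Proof.
elim/coset_ind: a => n; rewrite -[coset _ n]/(abc n) -[gact g _]/(ab_act g _).
rewrite ab_actE !H1_fun_abc.
have /inv_predP/(_ (ses_proj S g) isT) := H1Q_repr c; rewrite descendE.
rewrite -[gact g _]/(H1_act g _) H1_actE => /cls_eq/triv_B1/eqP.
rewrite subr_eq0 => /eqP /(congr1 (fun f : Z1 N M => f (conjN g n))) /= <-.
by rewrite -conjNMl mulVg conjN1.
Qed.
Definition H1_hom : ghom (abmod N) M := @GHom G (abmod N) M H1_fun H1_fun_act.

Lemma H1_homE (d0 : Z1 N M) n : cls (B1 N M) d0 = inval c -> H1_hom (abc n) = d0 n.
Proof.
rewrite -[inval c]reprK => /cls_eq/triv_B1/eqP; rewrite subr_eq0 => /eqP ->.
exact: H1_fun_abc.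
Qed.
End H1Hom.

(* Main.v *)
Require Import Defs.
From HB Require Import structures.
From mathcomp Require Import all_boot all_order all_algebra.
From mathcomp Require Import boolp.
Import GRing.Theory.

(** The two extensions being compared are related by an explicit morphism.
    Write [H] for the graph of [d] in the semidirect product of [M] by [G].
    Since [N] acts trivially on [M], inner derivations vanish, so invariance of
    the class of [d] means that [d] itself is [G]-equivariant, and this gives
    that each [(0, g)] normalises [H].  As [d] kills [N'], the assignment
    [g N' |-> (0, g) H] is a group homomorphism from [G/N'] to [N(H)/H] over
    [Q].  On [n] in [N] it takes the value [(0, n) H = (- d n, 1) H], because
    [(0, n) = (- d n, 1) (d n, n)].  It is therefore a morphism of extensions
    restricting to [- d] on the kernels ([graph_coset_inj], [graph_coset_proj]),
    and a morphism of extensions over [Q] pushes the class of its source forward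
    to the class of its target ([ext_class_push]).  Hence [tr d] is the image of
    [epsilon] under [- d] ([tr_push]), up to the identification of [M^N] with
    [M].  The second equality is the first one for [- d]. *)

Set Implicit Arguments.
Unset Strict Implicit.
Unset Printing Implicit Defensive.
Local Open Scope ring_scope.

Section H2Functor.
Variables (Q : groupType) (A B C : gmodule Q).

Lemma H2_map_comp_opp (f : ghom A B) (g : ghom B C) (h : ghom A C) c :
  (forall a, g (f a) = - h a) -> H2_map g (H2_map f c) = - H2_map h c.
Proof.
move=> gf; elim/cls_ind: c => u; rewrite !H2_mapE -raddfN.
congr (cls (B2 C) _); apply: val_inj.
by apply/funext => x; apply/funext => y; exact: gf.
Qed.

Lemma H2_map_opp (f g : ghom A B) c :
  (forall a, f a = - g a) -> H2_map f c = - H2_map g c.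
Proof.
move=> fg; elim/cls_ind: c => u; rewrite !H2_mapE -raddfN.
congr (cls (B2 B) _); apply: val_inj.
by apply/funext => x; apply/funext => y; exact: fg.
Qed.

(** Composing a section of [E] with [phi] gives a section of [F], whose factor
    set is the image under [f] of the factor set of [E]. *)
Lemma ext_class_push (f : ghom A B) (E : extension A) (F : extension B)
    (phi : ext_grp E -> ext_grp F) :
  {morph phi : x y / (x * y)%g} -> (forall a, phi (ext_i E a) = ext_i F (f a)) ->
  (forall e, ext_p (phi e) = ext_p e) -> H2_map f (ext_class E) = ext_class F.
Proof.
move=> phiM phii phip; have [s sK] := ext_section E.
have tK : cancel (phi \o s) (@ext_p _ _ F) by move=> q; rewrite /= phip.
rewrite (ext_classE sK) (ext_classE tK) H2_mapE; congr (cls _ _); apply: val_inj.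
apply/funext => x; apply/funext => y; apply: (@ext_inj _ _ F).
apply: (mulIg (phi (s (x * y)%g))); rewrite [RHS](factorE tK) /=.
by rewrite -phii -phiM factorE phiM.
Qed.

End H2Functor.

Section Comparison.
Variables (G Q : groupType) (S : ses G Q) (M : gmodule G).
Notation N := (ses_ker S).
Hypothesis NM : forall n, n \in N -> forall m : M, gact n m = m.

Lemma triv_inv_pred (m : M) : m \in inv_pred N M.
Proof. by apply/inv_predP => n hn; exact: NM. Qed.

Variable c : H1Q S M.
Notation d := (repr (inval c) : Z1 N M).
Notation H := (graph d).

(** The map [- d], with values in [M^N] because the kernel of the transgression
    extension is [M^N] rather than [M]. *)
Definition opp_fun (a : abmod N) : invN N M :=
  Invariant (triv_inv_pred (- H1_hom NM c a)).

Lemma opp_funB : zmod_morphism opp_fun.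
Proof. by move=> a b; apply: val_inj; rewrite /= raddfB opprD. Qed.
HB.instance Definition _ :=
  GRing.isZmodMorphism.Build (abmod N) (invN N M) opp_fun opp_funB.

Lemma opp_fun_act g a : opp_fun (gact g a) = gact g (opp_fun a).
Proof.
by apply: val_inj; rewrite /= -[H1_fun c _]/(H1_hom NM c _) ghomE gactN.
Qed.
Definition opp_hom : ghom (abmod N) (invN N M) :=
  @GHom G (abmod N) (invN N M) opp_fun opp_fun_act.

(** Normalising the graph by [(0, g)] amounts to [g (d n) = d (g n g^-1)]. *)
Lemma graph_norm0 g : sdp 0 g \in normalizer H.
Proof.
apply/graph_normP => n; rewrite add0r gact0 subr0.
by rewrite -!(H1_fun_abc NM) -(H1_fun_act NM) -[gact g _]/(ab_act g _) ab_actE.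
Qed.

Definition norm0_coset (g : G) : norm_quot H :=
  coset (in_norm H) (SubG (graph_norm0 g)).

Lemma norm0_cosetM : {morph norm0_coset : x y / (x * y)%g}.
Proof.
move=> x y; rewrite /norm0_coset -cosetM; congr (coset _ _); apply: val_inj.
by rewrite /= sdM gact0 addr0.
Qed.

Definition graph_coset : quotg (derN N) -> norm_quot H := quotg_lift norm0_coset.

(** Well defined because [d] kills [N'], so that [(0, n)] lies in the graph of
    [d] for [n] in [N']. *)
Lemma graph_cosetE g : graph_coset (coset (derN N) g) = norm0_coset g.
Proof.
rewrite /graph_coset quotg_liftE // => x y /derNP [n hn e].
apply/coset_eq/graphP; exists n.
by rewrite (triv_der_derg NM _ hn) e /= sdV sdM gact0 oppr0 addr0.
Qed.

Lemma graph_cosetM : {morph graph_coset : x y / (x * y)%g}.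
Proof.
move=> a b; elim/coset_ind: a => x; elim/coset_ind: b => y.
by rewrite -cosetM !graph_cosetE norm0_cosetM.
Qed.

(** The origin of the sign: [(- d n, 1) (d n, n) = (0, n)], where the second
    factor lies in the graph. *)
Lemma graph_coset_inj a : graph_coset (ab_incl a) = tr_i d (opp_fun a).
Proof.
elim/coset_ind: a => n; rewrite -[coset _ n]/(abc n) ab_inclE graph_cosetE.
apply/esym/coset_eq/graphP; exists n.
rewrite /= -[H1_fun c _]/(H1_fun c (abc n)) (H1_fun_abc NM).
by rewrite sdV sdM invg1 !gact1 opprK addr0 mul1g.
Qed.

Lemma graph_coset_proj e : tr_p (graph_coset e) = ab_proj e.
Proof. by elim/coset_ind: e => g; rewrite graph_cosetE tr_pE ab_projE. Qed.

Lemma tr_push :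
  tr c = H2_map (descend_hom (@abmod_triv G N) (@invN_triv G N M) opp_hom)
           (ext_class (ab_ext S)).
Proof.
apply/esym/(@ext_class_push _ _ _ _ (ab_ext S) (tr_ext (H1Q_repr c)) graph_coset).
- exact: graph_cosetM.
- exact: graph_coset_inj.
- exact: graph_coset_proj.
Qed.

Lemma H1_homN a : H1_hom NM (- c) a = - H1_hom NM c a.
Proof.
elim/coset_ind: a => n; rewrite -[coset _ n]/(abc n).
have -> : H1_hom NM c (abc n) = d n by exact: H1_fun_abc.
apply: (H1_homE NM (d0 := - d)); rewrite !raddfN; congr (- _).
exact: reprK.
Qed.

End Comparison.

(* d ranges over H^1(N, M)^Q, and H1_hom NM d : N/N' -> M is the corresponding
   G-homomorphism; the first map identifies H^2(Q, M^N) with H^2(Q, M). *)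
Theorem lemma9p1 (G Q : groupType) (S : ses G Q) (M : gmodule G)
    (NM : forall n : G, n \in ses_ker S -> forall m : M, gact n m = m)
    (d : H1Q S M) :
  let incl_ : H2 (descend (@invN_triv G (ses_ker S) M)) -> H2 (descend NM) :=
    H2_map (descend_hom (@invN_triv G (ses_ker S) M) NM (invN_incl (ses_ker S) M)) in
  let d_ : H2 (descend (@abmod_triv G (ses_ker S))) -> H2 (descend NM) :=
    H2_map (descend_hom (@abmod_triv G (ses_ker S)) NM (H1_hom NM d)) in
  let epsilon : H2 (descend (@abmod_triv G (ses_ker S))) := ext_class (ab_ext S) in
  incl_ (tr d) = - d_ epsilon /\ incl_ (tr (- d)) = d_ epsilon.
Proof.
move=> incl_ d_ epsilon.
have trN (c : H1Q S M) : incl_ (tr c) =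
    - H2_map (descend_hom (@abmod_triv G (ses_ker S)) NM (H1_hom NM c)) epsilon.
  by rewrite (tr_push NM c); exact: H2_map_comp_opp.
split; first exact: trN.
rewrite trN; apply/eqP; rewrite eqr_oppLR; apply/eqP.
by apply: H2_map_opp => a; exact: (H1_homN NM d a).
Qed.
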